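(* A family $\{(\mathcal{A}_{k,\ell},\mathcal{A}_{k,r})\}_{k\in K}$ of non-unital pairs of $\mathcal{B}$-algebras in a $\mathcal{B}$-$\mathcal{B}$-non-commutative probability space $(\mathcal{A},\mathbb{E},\varepsilon)$ is bi-Boolean independent over $\mathcal{B}$ if and only if for all $n\ge2$, $\chi:\{1,\dots,n\}\to\{\ell,r\}$, $\omega:\{1,\dots,n\}\to K$, and $Z_j\in\mathcal{A}_{\omega(j),\chi(j)}$, we have $$B_{1_\chi}(Z_1,\dots,Z_n)=0$$ whenever $\omega$ is not constant.
   Context: $\mathcal{B}$ is a unital algebra over $\mathbb{C}$. A $\mathcal{B}$-$\mathcal{B}$-non-commutative probability space is a triple $(\mathcal{A},\mathbb{E},\varepsilon)$ where $\mathcal{A}$ is a unital complex algebra, $\varepsilon:\mathcal{B}\otimes\mathcal{B}^{\mathrm{op}}\to\mathcal{A}$ is a unital homomorphism with $\varepsilon|_{\mathcal{B}\otimes1_{\mathcal{B}}}$ and $\varepsilon|_{1_{\mathcal{B}}\otimes\mathcal{B}^{\mathrm{op}}}$ injective, and $\mathbb{E}:\mathcal{A}\to\mathcal{B}$ is a unital linear map with $\mathbb{E}(\varepsilon(b_1\otimes b_2)Z)=b_1\mathbb{E}(Z)b_2$ and $\mathbb{E}(Z\varepsilon(b\otimes1_{\mathcal{B}}))=\mathbb{E}(Z\varepsilon(1_{\mathcal{B}}\otimes b))$ for all $b_1,b_2,b\in\mathcal{B}$, $Z\in\mathcal{A}$. The left algebra $\mathcal{A}_\ell$ is the set of $Z\in\mathcal{A}$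 commuting with all $\varepsilon(1_{\mathcal{B}}\otimes b)$, and the right algebra $\mathcal{A}_r$ is the set of $Z\in\mathcal{A}$ commuting with all $\varepsilon(b\otimes1_{\mathcal{B}})$, $b\in\mathcal{B}$. A non-unital pair of $\mathcal{B}$-algebras is an ordered pair $(\mathcal{C}_\ell,\mathcal{C}_r)$ of subalgebras of $\mathcal{A}$ with $\varepsilon(\mathcal{B}\otimes1_{\mathcal{B}})\subset\mathcal{C}_\ell\subset\mathcal{A}_\ell$ and $\varepsilon(1_{\mathcal{B}}\otimes\mathcal{B}^{\mathrm{op}})\subset\mathcal{C}_r\subset\mathcal{A}_r$. For $\chi:\{1,\dots,n\}\to\{\ell,r\}$ with $\chi^{-1}(\{\ell\})=\{i_1<\cdots<i_p\}$ and $\chi^{-1}(\{r\})=\{i_{p+1}>\cdots>i_n\}$, let $\prec_\chi$ be the total order $i_1\prec_\chi\cdots\prec_\chi i_n$; a $\chi$-interval is an interval for $\prec_\chi$. $\mathrm{BI}(\chi)$ is the lattice (under refinement $\le$) of partitions of $\{1,\dots,n\}$ all of whose blocks are $\chi$-intervals, with maximal element $1_\chi=\{\{1,\dots,n\}\}$; its Möbius function is $\mu_{\mathrm{BI}}(\sigma,\pi)=(-1)^{|\sigma|-|\pi|}$ for $\sigma\le\pi$. For $Z_j\in\mathcal{A}_{\chi(j)}$ and $\pi\in\mathrm{BI}(\chi)$ with blocks $V_1,\dots,V_m$ ordered by $\prec_\chi$, the operator-valued moment function is $\mathcal{E}_\pi(Z_1,\dots,Z_n)=\mathbb{E}(Z_{V_1})\mathbb{E}(Z_{V_2})\cdots\mathbb{E}(Z_{V_m})$,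 where $Z_V=Z_{v_1}\cdots Z_{v_s}$ for $V=\{v_1<\cdots<v_s\}$ (this is the operator-valued bi-free moment function restricted to bi-interval partitions). The operator-valued bi-Boolean cumulant function is $$B_\pi(Z_1,\dots,Z_n)=\sum_{\sigma\in\mathrm{BI}(\chi),\ \sigma\le\pi}\mathcal{E}_\sigma(Z_1,\dots,Z_n)\,\mu_{\mathrm{BI}}(\sigma,\pi).$$ For $\omega:\{1,\dots,n\}\to K$, $\pi_{\omega,\chi}$ is the unique maximal partition of $\{1,\dots,n\}$ whose blocks are $\chi$-intervals on each of which $\omega$ is constant. A family $\{(\mathcal{A}_{k,\ell},\mathcal{A}_{k,r})\}_{k\in K}$ of non-unital pairs of $\mathcal{B}$-algebras is bi-Boolean independent with amalgamation over $\mathcal{B}$ if $\mathbb{E}(Z_1\cdots Z_n)=\mathcal{E}_{\pi_{\omega,\chi}}(Z_1,\dots,Z_n)$ for all $n\ge1$, $\chi:\{1,\dots,n\}\to\{\ell,r\}$, $\omega:\{1,\dots,n\}\to K$, and $Z_j\in\mathcal{A}_{\omega(j),\chi(j)}$. *)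

(* Defs.v *)
From HB Require Import structures.
From mathcomp Require Import all_boot all_order all_algebra.
From mathcomp Require Import boolp sesquilinear generic_quotient.

Set Implicit Arguments.
Unset Strict Implicit.
Unset Printing Implicit Defensive.

Import GRing.Theory.
Local Open Scope ring_scope.
Local Open Scope quotient_scope.

(* The opposite algebra B^op is the converse ring B^c of MathComp, with the
   scalar action of B. *)
HB.instance Definition _ (K : pzRingType) (V : lmodType K) :=
  GRing.Lmodule.copy V^c V.
HB.instance Definition _ (K : pzRingType) (B : algType K) :=
  GRing.LSemiModule_isLSemiAlgebra.Build K B^c
    (fun (a : K) (u v : B) => scalerAr a v u).
HB.instance Definition _ (K : pzRingType) (B : algType K) :=
  GRing.LSemiAlgebra_isSemiAlgebra.Build K B^c
    (fun (a : K) (u v : B) => scalerAl a v u).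

(* The tensor product over K of two K-modules, as a quotient of the formal sums
   of pairs: a formal sum [:: (u1, v1); ...; (um, vm)] stands for
   u1 (x) v1 + ... + um (x) vm, and two formal sums are identified when no
   bilinear map tells them apart.  The universal property is tens_liftE and
   tens_ind below. *)
Section TensorModule.
Variables (K : comNzRingType) (U V : lmodType K).

Definition formal_eval (W : zmodType) (f : U -> V -> W) (s : seq (U * V)) : W :=
  \sum_(p <- s) f p.1 p.2.

Definition formal_eq (s t : seq (U * V)) : Prop :=
  forall (W : lmodType K) (f : {bilinear U -> V -> W}),
    formal_eval f s = formal_eval f t.

Definition formal_eqb (s t : seq (U * V)) : bool := `[< formal_eq s t >].

Lemma formal_eqb_is_equiv : equiv_class_of formal_eqb.
Proof.
split=> [s|s t|t s r]; first exact/asboolP.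
- by apply/asboolP/asboolP => h W f; rewrite h.
- by move=> /asboolP h1 /asboolP h2; apply/asboolP => W f; rewrite h1.
Qed.

Canonical formal_eqb_equiv := EquivRelPack formal_eqb_is_equiv.
Canonical formal_eqb_encModRel := defaultEncModRel formal_eqb.

Definition tensor := {eq_quot formal_eqb}.
HB.instance Definition _ : EqQuotient _ formal_eqb tensor :=
  EqQuotient.on tensor.
HB.instance Definition _ := Choice.on tensor.

Definition tens (u : U) (v : V) : tensor := \pi_tensor [:: (u, v)].

Lemma tensP (s t : seq (U * V)) :
  reflect (formal_eq s t) (\pi_tensor s == \pi_tensor t).
Proof. by rewrite eqmodE; exact: asboolP. Qed.

Lemma tensW (P : tensor -> Prop) :
  (forall s, P (\pi_tensor s)) -> forall x, P x.
Proof. by move=> h x; rewrite -[x]reprK. Qed.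

Lemma repr_formal_eq (s : seq (U * V)) : formal_eq (repr (\pi_tensor s)) s.
Proof. by apply/tensP; rewrite reprK. Qed.

Lemma formal_eval_cat (W : zmodType) (f : U -> V -> W) s t :
  formal_eval f (s ++ t) = formal_eval f s + formal_eval f t.
Proof. exact: big_cat. Qed.

Definition tens_zero : tensor := \pi_tensor [::].
Definition tens_add (x y : tensor) : tensor := \pi_tensor (repr x ++ repr y).
Definition formal_scale (a : K) (s : seq (U * V)) : seq (U * V) :=
  [seq (a *: p.1, p.2) | p <- s].
Definition tens_scale (a : K) (x : tensor) : tensor :=
  \pi_tensor (formal_scale a (repr x)).
Definition tens_opp (x : tensor) : tensor := tens_scale (-1) x.

Lemma formal_eval_scale (W : lmodType K) (f : {bilinear U -> V -> W}) a s :
  formal_eval f (formal_scale a s) = a *: formal_eval f s.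
Proof.
rewrite /formal_eval big_map scaler_sumr; apply: eq_bigr => p _ /=.
by rewrite linearZl_LR.
Qed.

Lemma tens_add_pi s t :
  tens_add (\pi_tensor s) (\pi_tensor t) = \pi_tensor (s ++ t).
Proof.
apply/eqP/tensP => W f.
by rewrite !formal_eval_cat (repr_formal_eq s) (repr_formal_eq t).
Qed.

Lemma tens_scale_pi a s :
  tens_scale a (\pi_tensor s) = \pi_tensor (formal_scale a s).
Proof.
apply/eqP/tensP => W f.
by rewrite !formal_eval_scale (repr_formal_eq s).
Qed.

Lemma tens_addA : associative tens_add.
Proof.
elim/tensW=> s; elim/tensW=> t; elim/tensW=> r.
by rewrite !tens_add_pi catA.
Qed.

Lemma tens_addC : commutative tens_add.
Proof.
elim/tensW=> s; elim/tensW=> t; rewrite !tens_add_pi.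
by apply/eqP/tensP => W f; rewrite !formal_eval_cat addrC.
Qed.

Lemma tens_add0 : left_id tens_zero tens_add.
Proof. by elim/tensW=> s; rewrite tens_add_pi. Qed.

Lemma tens_addN : left_inverse tens_zero tens_opp tens_add.
Proof.
elim/tensW=> s; rewrite /tens_opp tens_scale_pi tens_add_pi.
apply/eqP/tensP => W f.
by rewrite formal_eval_cat formal_eval_scale scaleN1r addNr /formal_eval big_nil.
Qed.

HB.instance Definition _ :=
  GRing.isZmodule.Build tensor tens_addA tens_addC tens_add0 tens_addN.

Lemma pi_tensD s t : \pi_tensor (s ++ t) = \pi_tensor s + \pi_tensor t.
Proof. exact/esym/tens_add_pi. Qed.

Lemma tens_scaleA a b (x : tensor) :
  tens_scale a (tens_scale b x) = tens_scale (a * b) x.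
Proof.
elim/tensW: x => s; rewrite !tens_scale_pi; apply/eqP/tensP => W f.
by rewrite !formal_eval_scale scalerA.
Qed.

Lemma tens_scale1 : left_id 1 tens_scale.
Proof.
elim/tensW=> s; rewrite !tens_scale_pi; apply/eqP/tensP => W f.
by rewrite !formal_eval_scale scale1r.
Qed.

Lemma tens_scaleDr : right_distributive tens_scale +%R.
Proof.
move=> a; elim/tensW=> s; elim/tensW=> t.
rewrite -pi_tensD !tens_scale_pi -pi_tensD.
by apply/eqP/tensP => W f; rewrite formal_eval_cat !formal_eval_scale
  formal_eval_cat scalerDr.
Qed.

Lemma tens_scaleDl x : {morph tens_scale^~ x : a b / a + b}.
Proof.
elim/tensW: x => s a b; rewrite !tens_scale_pi -pi_tensD.
by apply/eqP/tensP => W f; rewrite formal_eval_cat !formal_eval_scale scalerDl.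
Qed.

HB.instance Definition _ := GRing.Zmodule_isLmodule.Build K tensor
  tens_scaleA tens_scale1 tens_scaleDr tens_scaleDl.

Lemma pi_tensZ a s : a *: \pi_tensor s = \pi_tensor (formal_scale a s).
Proof. exact: tens_scale_pi. Qed.

Lemma formal_eval1 (W : zmodType) (f : U -> V -> W) u v :
  formal_eval f [:: (u, v)] = f u v.
Proof. exact: big_seq1. Qed.

Lemma tens_is_bilinear : bilinear_for *:%R *:%R tens.
Proof.
split=> [v a u1 u2|u a v1 v2] /=.
- rewrite /tens pi_tensZ -pi_tensD; apply/eqP/tensP => W f.
  rewrite formal_eval_cat formal_eval_scale !formal_eval1.
  by rewrite linearPl.
- rewrite /tens pi_tensZ -pi_tensD; apply/eqP/tensP => W f.
  rewrite formal_eval_cat formal_eval_scale !formal_eval1.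
  by rewrite linearPr.
Qed.

HB.instance Definition _ := bilinear_isBilinear.Build K U V tensor *:%R *:%R
  tens tens_is_bilinear.

Lemma tens_sumE (x : tensor) : x = \sum_(p <- repr x) tens p.1 p.2.
Proof.
rewrite -[LHS]reprK; elim: (repr x) => [|[u v] s IH].
  by rewrite big_nil.
by rewrite big_cons -cat1s pi_tensD IH.
Qed.

Lemma tens_ind (P : tensor -> Prop) :
  P 0 -> (forall u v x, P x -> P (tens u v + x)) -> forall x, P x.
Proof.
move=> P0 PD x; rewrite [x]tens_sumE; elim: (repr x) => [|p s IH].
  by rewrite big_nil.
by rewrite big_cons; exact: PD.
Qed.

Definition tens_lift (W : lmodType K) (f : {bilinear U -> V -> W})
  (x : tensor) : W := formal_eval f (repr x).

Lemma tens_lift_is_linear (W : lmodType K) (f : {bilinear U -> V -> W}) :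
  linear (tens_lift f).
Proof.
move=> a; elim/tensW=> s; elim/tensW=> t.
rewrite pi_tensZ -pi_tensD /tens_lift !(repr_formal_eq _).
by rewrite formal_eval_cat formal_eval_scale.
Qed.

HB.instance Definition _ (W : lmodType K) (f : {bilinear U -> V -> W}) :=
  GRing.isLinear.Build K tensor W *:%R (tens_lift f) (tens_lift_is_linear f).

Lemma tens_liftE (W : lmodType K) (f : {bilinear U -> V -> W}) u v :
  tens_lift f (tens u v) = f u v.
Proof. by rewrite /tens_lift (repr_formal_eq _) formal_eval1. Qed.

End TensorModule.

Section TensorAlgebra.
Variables (K : comNzRingType) (A A' : algType K).
Notation T := (tensor A A').

Definition formal_mul (s t : seq (A * A')) : seq (A * A') :=
  [seq (p.1 * q.1, p.2 * q.2) | p <- s, q <- t].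
Definition tens_mul (x y : T) : T := \pi_T (formal_mul (repr x) (repr y)).
Definition tens_one : T := tens 1 1.

Section Twist.
Variables (W : lmodType K) (f : {bilinear A -> A' -> W}) (a : A) (a' : A').

Definition twistl (u : A) (v : A') : W := f (a * u) (a' * v).
Definition twistr (u : A) (v : A') : W := f (u * a) (v * a').

Lemma twistl_is_bilinear : bilinear_for *:%R *:%R twistl.
Proof.
split=> [v c u1 u2|u c v1 v2] /=; rewrite /twistl mulrDr -scalerAr.
- exact: linearPl.
- exact: linearPr.
Qed.

Lemma twistr_is_bilinear : bilinear_for *:%R *:%R twistr.
Proof.
split=> [v c u1 u2|u c v1 v2] /=; rewrite /twistr mulrDl -scalerAl.
- exact: linearPl.
- exact: linearPr.
Qed.

HB.instance Definition _ := bilinear_isBilinear.Build K A A' W *:%R *:%R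
  twistl twistl_is_bilinear.
HB.instance Definition _ := bilinear_isBilinear.Build K A A' W *:%R *:%R
  twistr twistr_is_bilinear.

End Twist.

Lemma formal_eval_mul (W : zmodType) (f : A -> A' -> W) s t :
  formal_eval f (formal_mul s t) =
  \sum_(p <- s) \sum_(q <- t) f (p.1 * q.1) (p.2 * q.2).
Proof. by rewrite /formal_eval big_allpairs_dep. Qed.

Lemma pi_tensM s t : tens_mul (\pi_T s) (\pi_T t) = \pi_T (formal_mul s t).
Proof.
apply/eqP/tensP => W f; rewrite !formal_eval_mul.
under eq_bigr => p _ do
  rewrite -/(formal_eval (twistl f p.1 p.2) _) (repr_formal_eq t (twistl f p.1 p.2)).
rewrite exchange_big [RHS]exchange_big; apply: eq_bigr => q _ /=.
exact: (repr_formal_eq s (twistr f q.1 q.2)).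
Qed.

Lemma tens_mulA : associative tens_mul.
Proof.
elim/tensW=> s; elim/tensW=> t; elim/tensW=> r.
rewrite !pi_tensM; apply/eqP/tensP => W f; rewrite !formal_eval_mul.
rewrite big_allpairs_dep; apply: eq_bigr => p _.
rewrite big_allpairs_dep; apply: eq_bigr => q _.
by apply: eq_bigr => z _; rewrite !mulrA.
Qed.

Lemma tens_mul1 : left_id tens_one tens_mul.
Proof.
elim/tensW=> s; rewrite pi_tensM; apply/eqP/tensP => W f.
rewrite formal_eval_mul big_seq1 /=.
by apply: eq_bigr => p _; rewrite !mul1r.
Qed.

Lemma tens_mulr1 : right_id tens_one tens_mul.
Proof.
elim/tensW=> s; rewrite pi_tensM; apply/eqP/tensP => W f.
rewrite formal_eval_mul.
by apply: eq_bigr => p _; rewrite big_seq1 !mulr1.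
Qed.

Lemma tens_mulDl : left_distributive tens_mul +%R.
Proof.
elim/tensW=> s; elim/tensW=> t; elim/tensW=> r.
rewrite -pi_tensD !pi_tensM -pi_tensD; apply/eqP/tensP => W f.
by rewrite formal_eval_cat !formal_eval_mul big_cat.
Qed.

Lemma tens_mulDr : right_distributive tens_mul +%R.
Proof.
elim/tensW=> s; elim/tensW=> t; elim/tensW=> r.
rewrite -pi_tensD !pi_tensM -pi_tensD; apply/eqP/tensP => W f.
rewrite formal_eval_cat !formal_eval_mul -big_split /=.
by apply: eq_bigr => p _; rewrite big_cat.
Qed.

HB.instance Definition _ := GRing.Zmodule_isPzRing.Build T
  tens_mulA tens_mul1 tens_mulr1 tens_mulDl tens_mulDr.

Lemma pi_tensE s t : \pi_T s * \pi_T t = \pi_T (formal_mul s t).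
Proof. exact: pi_tensM. Qed.

Lemma tensM (a b : A) (a' b' : A') :
  tens a a' * tens b b' = tens (a * b) (a' * b') :> T.
Proof. exact: pi_tensM. Qed.

Lemma tens_scaleAl (c : K) (x y : T) : c *: (x * y) = (c *: x) * y.
Proof.
elim/tensW: x => s; elim/tensW: y => t.
rewrite [c *: \pi_T s]pi_tensZ !pi_tensE pi_tensZ.
apply/eqP/tensP => W f; rewrite formal_eval_scale !formal_eval_mul.
rewrite big_map scaler_sumr; apply: eq_bigr => p _.
rewrite scaler_sumr; apply: eq_bigr => q _ /=.
by rewrite -scalerAl linearZl_LR.
Qed.

Lemma tens_scaleAr (c : K) (x y : T) : c *: (x * y) = x * (c *: y).
Proof.
elim/tensW: x => s; elim/tensW: y => t.
rewrite [c *: \pi_T t]pi_tensZ !pi_tensE pi_tensZ.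
apply/eqP/tensP => W f; rewrite formal_eval_scale !formal_eval_mul.
rewrite scaler_sumr; apply: eq_bigr => p _.
rewrite big_map scaler_sumr; apply: eq_bigr => q _ /=.
by rewrite -scalerAr linearZl_LR.
Qed.

End TensorAlgebra.

Section EnvelopingAlgebra.
Variables (K : comNzRingType) (B : algType K).
Notation T := (tensor B B^c).

Definition mul_op (b : B) (b' : B^c) : B := b * (b' : B).

Lemma mul_op_is_bilinear : bilinear_for *:%R *:%R mul_op.
Proof.
split=> [v c u1 u2|u c v1 v2] /=; rewrite /mul_op.
- by rewrite mulrDl -scalerAl.
- by rewrite mulrDr -scalerAr.
Qed.

HB.instance Definition _ := bilinear_isBilinear.Build K B B^c B *:%R *:%R
  mul_op mul_op_is_bilinear.

Lemma tens_one_neq0 : (1 : T) != 0.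
Proof.
apply/eqP => /(congr1 (tens_lift mul_op)).
rewrite [LHS]tens_liftE linear0 [LHS](mulr1 (1 : B)) => /eqP.
by rewrite oner_eq0.
Qed.

HB.instance Definition _ := GRing.PzSemiRing_isNonZero.Build T tens_one_neq0.
HB.instance Definition _ :=
  GRing.Lmodule_isLalgebra.Build K T (@tens_scaleAl K B B^c).
HB.instance Definition _ :=
  GRing.Lalgebra_isAlgebra.Build K T (@tens_scaleAr K B B^c).

End EnvelopingAlgebra.

Variant side := Lft | Rgt.

Definition is_left (s : side) : bool := if s is Lft then true else false.

Section BiIntervals.
Variable n : nat.
Implicit Types (chi : 'I_n -> side) (V W : {set 'I_n})
  (sigma pi rho : {set {set 'I_n}}).

(* 'I_n stands for {1, ..., n}; chi_enum lists it in the order <_chi. *)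
Definition chi_enum chi : seq 'I_n :=
  [seq i <- enum 'I_n | is_left (chi i)] ++
  rev [seq i <- enum 'I_n | ~~ is_left (chi i)].

Definition chi_pos chi (i : 'I_n) : nat := index i (chi_enum chi).

Definition chi_lt chi : rel 'I_n := [rel i j | (chi_pos chi i < chi_pos chi j)%N].

Definition chi_interval chi V : bool :=
  [forall i in V, forall j in V, forall k,
    (chi_lt chi i k && chi_lt chi k j) ==> (k \in V)].

Definition BI chi : {set {set {set 'I_n}}} :=
  [set pi | partition pi [set: 'I_n] & [forall V in pi, chi_interval chi V]].

Definition refines sigma pi : bool :=
  [forall V in sigma, exists W in pi, V \subset W].

Definition one_chi : {set {set 'I_n}} := [set [set: 'I_n]].

(* The Moebius function of BI chi, see mu_BI_moebius below; it is only meant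
   for sigma <= pi, where the subtraction is exact. *)
Definition mu_BI sigma pi : int := (-1) ^+ (#|sigma| - #|pi|).

(* The order <_chi on the blocks of a partition in BI chi. *)
Definition block_le chi : rel {set 'I_n} :=
  [rel V W : {set 'I_n} | (V == W) || [forall i in V, forall j in W, chi_lt chi i j]].

Definition chi_blocks chi pi : seq {set 'I_n} := sort (block_le chi) (enum pi).

Section Cuts.
Variable chi : 'I_n -> side.
Notation pos := (chi_pos chi).

Lemma perm_chi_enum : perm_eq (chi_enum chi) (enum 'I_n).
Proof. by rewrite /chi_enum (perm_catl _ (permEl (perm_rev _))) perm_filterC. Qed.

Lemma mem_chi_enum i : i \in chi_enum chi.
Proof. by rewrite (perm_mem perm_chi_enum) mem_enum. Qed.

Lemma size_chi_enum : size (chi_enum chi) = n.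
Proof. by rewrite (perm_size perm_chi_enum) size_enum_ord. Qed.

Lemma chi_pos_lt i : (pos i < n)%N.
Proof. by rewrite -[X in (_ < X)%N]size_chi_enum index_mem mem_chi_enum. Qed.

Lemma chi_pos_inj : injective pos.
Proof. by move=> i j /(congr1 (nth i (chi_enum chi))); rewrite !nth_index ?mem_chi_enum. Qed.

Lemma chi_pos_surj k : (k < n)%N -> exists i, pos i = k.
Proof.
move=> lt_k_n; have i0 := Ordinal lt_k_n.
exists (nth i0 (chi_enum chi) k); rewrite /chi_pos index_uniq ?size_chi_enum //.
by rewrite (perm_uniq perm_chi_enum) enum_uniq.
Qed.

Lemma BI_P pi : reflect
  [/\ partition pi [set: 'I_n] & forall V i j k, V \in pi -> i \in V -> j \in V ->
     (pos i <= pos k <= pos j)%N -> k \in V] (pi \in BI chi).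
Proof.
rewrite inE; apply: (iffP andP) => -[piP Iv]; split=> //.
- move=> V i j k Vpi iV jV /andP[ik kj].
  move: ik; rewrite leq_eqVlt => /orP[/eqP/chi_pos_inj<- //|ik].
  move: kj; rewrite leq_eqVlt => /orP[/eqP/chi_pos_inj-> //|kj].
  move/forall_inP: Iv => /(_ V Vpi)/forall_inP/(_ i iV)/forall_inP/(_ j jV).
  by move/forallP/(_ k)/implyP; apply; rewrite /chi_lt /= ik.
- apply/forall_inP => V Vpi; apply/forall_inP => i iV; apply/forall_inP => j jV.
  apply/forallP => k; apply/implyP => /andP[/ltnW ik /ltnW kj].
  by apply: (Iv V i j k) => //; rewrite ik.
Qed.

(* A partition in BI chi is determined by the <_chi-last elements of its blocks;
   cut_part is the inverse of this correspondence. *)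
Definition cut_count (S : {set 'I_n}) (i : 'I_n) : nat :=
  #|[set s in S | (pos s < pos i)%N]|.

Definition cut_part (S : {set 'I_n}) : {set {set 'I_n}} :=
  preim_partition (cut_count S) [set: 'I_n].

Lemma cut_count_le (S : {set 'I_n}) i j : (pos i <= pos j)%N -> (cut_count S i <= cut_count S j)%N.
Proof.
move=> ij; apply/subset_leq_card/subsetP => s; rewrite !inE => /andP[-> /=].
by move/leq_trans; apply.
Qed.

Lemma cut_count_eqP (S : {set 'I_n}) i j : (pos i <= pos j)%N ->
  reflect (forall s, s \in S -> (pos i <= pos s)%N -> (pos j <= pos s)%N)
    (cut_count S i == cut_count S j).
Proof.
move=> ij; apply: (iffP eqP) => [e s sS si|h].
- rewrite leqNgt; apply/negP => sj.
  suff: (cut_count S i < cut_count S j)%N by rewrite e ltnn.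
  apply/proper_card/properP; split.
    apply/subsetP => t; rewrite !inE => /andP[-> /=].
    by move/leq_trans; apply.
  by exists s; rewrite !inE sS //= -leqNgt.
- apply/eqP; rewrite eqn_leq cut_count_le //=.
  apply/subset_leq_card/subsetP => s; rewrite !inE => /andP[sS sj].
  rewrite sS /= ltnNge; apply: contraL sj => si.
  by rewrite -leqNgt h.
Qed.

Lemma cut_part_partition S : partition (cut_part S) [set: 'I_n].
Proof. exact: preim_partitionP. Qed.

Lemma cut_partE S i j :
  (j \in pblock (cut_part S) i) = (cut_count S i == cut_count S j).
Proof. by rewrite pblock_equivalence_partition ?inE //; split=> // /eqP->. Qed.

Lemma BI_trivIset pi : pi \in BI chi -> trivIset pi.
Proof. by case/BI_P => /and3P[]. Qed.

Lemma BI_mem_pblock pi i : pi \in BI chi -> i \in pblock pi i.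
Proof. by case/BI_P => /and3P[/eqP c _ _] _; rewrite mem_pblock c inE. Qed.

Lemma BI_pblock_mem pi i : pi \in BI chi -> pblock pi i \in pi.
Proof. by case/BI_P => /and3P[/eqP c _ _] _; rewrite pblock_mem // c inE. Qed.

Lemma BI_blockE pi V i : pi \in BI chi -> V \in pi -> i \in V -> V = pblock pi i.
Proof. by move=> /BI_trivIset tr Vpi iV; rewrite (def_pblock tr Vpi iV). Qed.

Lemma BI_block_ex pi V : pi \in BI chi -> V \in pi -> exists i, i \in V.
Proof.
case/BI_P => /and3P[_ _ n0] _ Vpi; apply/set0Pn.
by apply: contraNneq n0 => <-.
Qed.

Lemma cut_part_BI S : cut_part S \in BI chi.
Proof.
have := cut_part_partition S => SP; apply/BI_P; split=> // V i j k VS iV jV.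
case/and3P: SP => _ tr _ /andP[ik kj].
rewrite -(def_pblock tr VS iV) in jV *.
move: jV; rewrite !cut_partE => /eqP ij.
rewrite eqn_leq (cut_count_le S ik) ij.
exact: cut_count_le.
Qed.

Definition cuts pi : {set 'I_n} :=
  [set i | [forall j in pblock pi i, (pos j <= pos i)%N]].

Lemma refines_pblockP sigma pi : sigma \in BI chi -> pi \in BI chi ->
  reflect (forall i, pblock sigma i \subset pblock pi i) (refines sigma pi).
Proof.
move=> sBI pBI; apply: (iffP forall_inP) => [h i|h V Vs].
- have /exists_inP[W Wp sW] := h _ (BI_pblock_mem i sBI).
  by rewrite -(BI_blockE pBI Wp) // (subsetP sW) // BI_mem_pblock.
- have [i iV] := BI_block_ex sBI Vs.
  apply/exists_inP; exists (pblock pi i); first exact: BI_pblock_mem.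
  by rewrite (BI_blockE sBI Vs iV).
Qed.

Lemma pblock_sym pi i j : pi \in BI chi ->
  (j \in pblock pi i) = (i \in pblock pi j).
Proof.
move=> pBI; have tr := BI_trivIset pBI.
by apply/idP/idP => /(same_pblock tr) e; rewrite -?e ?e BI_mem_pblock.
Qed.

Lemma mem_pblock_cuts pi i j : pi \in BI chi ->
  (j \in pblock pi i) = (cut_count (cuts pi) i == cut_count (cuts pi) j).
Proof.
move=> pBI; wlog ij : i j / (pos i <= pos j)%N => [hw|].
  by case/orP: (leq_total (pos i) (pos j)) => /hw // e; rewrite pblock_sym // eq_sym.
have tr := BI_trivIset pBI; have [_ Ip] := BI_P _ pBI.
have bi := BI_pblock_mem i pBI; have ii := BI_mem_pblock i pBI.
apply/idP/cut_count_eqP => // [ji s|h].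
- rewrite inE => /forall_inP sc si; rewrite leqNgt; apply/negP => sj.
  have sb : s \in pblock pi i by apply: (Ip _ i j s bi) => //; rewrite si ltnW.
  by move: (sc j); rewrite (same_pblock tr sb) leqNgt sj => /(_ ji).
- have [m mb mmax] := arg_maxnP pos ii.
  have mc : m \in cuts pi.
    by rewrite inE; apply/forall_inP => k; rewrite (same_pblock tr mb); exact: mmax.
  by apply: (Ip _ i m j bi ii mb); rewrite ij /=; apply: h mc _; exact: mmax.
Qed.

Lemma cutsK pi : pi \in BI chi -> cut_part (cuts pi) = pi.
Proof.
move=> pBI; have [pP _] := BI_P _ pBI.
rewrite -[RHS](equivalence_partition_pblock pP); apply: eq_in_imset => i _.
by apply/setP => j; rewrite !inE mem_pblock_cuts.
Qed.

Lemma cut_partK (S : {set 'I_n}) :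
  (forall i, (pos i).+1 = n -> i \in S) -> cuts (cut_part S) = S.
Proof.
move=> Slast; apply/setP => i; rewrite inE; apply/forall_inP/idP => [h|iS j].
- have [/Slast //|lt_in] := eqVneq (pos i).+1 n.
  have {lt_in} : ((pos i).+1 < n)%N by rewrite ltn_neqAle lt_in chi_pos_lt.
  move=> /chi_pos_surj[j pj]; apply: contraT => iS.
  have: j \in pblock (cut_part S) i.
    rewrite cut_partE; apply/cut_count_eqP; rewrite pj // => s sS.
    rewrite leq_eqVlt => /orP[/eqP/chi_pos_inj e|//].
    by rewrite e sS in iS.
  by move=> /h; rewrite pj ltnn.
- rewrite cut_partE leqNgt => e; apply/negP => ij; move: e.
  by move=> /(cut_count_eqP _ (ltnW ij))/(_ i iS (leqnn _)); rewrite leqNgt ij.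
Qed.

Lemma cuts_last pi i : (pos i).+1 = n -> i \in cuts pi.
Proof.
move=> il; rewrite inE; apply/forall_inP => j _.
by rewrite -ltnS il chi_pos_lt.
Qed.

Lemma card_cuts pi : pi \in BI chi -> #|cuts pi| = #|pi|.
Proof.
move=> pBI; have [pP _] := BI_P _ pBI; suff: is_transversal (cuts pi) pi [set: 'I_n] by exact: card_transversal.
rewrite /is_transversal pP subsetT /=; apply/forall_inP => V Vpi.
have [i iV] := BI_block_ex pBI Vpi; have [m mV mmax] := arg_maxnP pos iV.
have tr := BI_trivIset pBI.
apply/cards1P; exists m; apply/setP => k; rewrite !inE.
apply/andP/eqP => [[/forall_inP kmax kV]|->].
- have km : (pos k <= pos m)%N := mmax k kV.
  apply: chi_pos_inj; apply/eqP; rewrite eqn_leq km /= kmax //.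
  by rewrite (def_pblock tr Vpi kV).
- by split=> //; apply/forall_inP => j; rewrite (def_pblock tr Vpi mV); exact: mmax.
Qed.

Lemma refines_cuts sigma pi : sigma \in BI chi -> pi \in BI chi ->
  refines sigma pi = (cuts pi \subset cuts sigma).
Proof.
move=> sBI pBI; apply/(refines_pblockP sBI pBI)/subsetP => [h i|h i].
- rewrite !inE => /forall_inP ic; apply/forall_inP => j ji.
  by apply: ic; apply: (subsetP (h i)).
apply/subsetP => j; rewrite !mem_pblock_cuts //.
wlog ij : i j / (pos i <= pos j)%N => [hw|].
  case/orP: (leq_total (pos i) (pos j)) => /hw // e.
  by rewrite eq_sym => /e; rewrite eq_sym.
move=> /(cut_count_eqP _ ij) hc; apply/cut_count_eqP => // s /h; exact: hc.
Qed.

Lemma refines_anti sigma pi : sigma \in BI chi -> pi \in BI chi ->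
  refines sigma pi -> refines pi sigma -> sigma = pi.
Proof.
move=> sBI pBI; rewrite !refines_cuts // => ps sp.
rewrite -(cutsK sBI) -(cutsK pBI); congr cut_part.
by apply/eqP; rewrite eqEsubset ps sp.
Qed.

Lemma mu_BI_moebius sigma pi :
  sigma \in BI chi -> pi \in BI chi -> refines sigma pi ->
  \sum_(tau in BI chi | refines sigma tau && refines tau pi) mu_BI sigma tau =
  (sigma == pi)%:R.
Proof.
move=> sBI pBI; rewrite refines_cuts // => sub.
rewrite (reindex_onto cut_part cuts) /=; last by move=> tau /andP[/cutsK].
rewrite (eq_bigl (fun S : {set 'I_n} =>
    (cuts pi \subset S) && (S \subset cuts sigma))); last first.
  move=> S; rewrite cut_part_BI /= !refines_cuts ?cut_part_BI //.
  apply/idP/idP.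
    by move=> /andP[/andP[a b] /eqP e]; rewrite e in a b; rewrite a b.
  move=> /andP[a b]; rewrite cut_partK ?a ?b ?eqxx // => i /(cuts_last pi).
  exact/subsetP.
rewrite (eq_bigr (fun S : {set 'I_n} => (-1) ^+ (#|cuts sigma| - #|S|))); last first.
  move=> S /andP[a b]; rewrite /mu_BI -(card_cuts sBI).
  rewrite -(card_cuts (cut_part_BI S)) cut_partK // => i /(cuts_last pi).
  exact/subsetP.
have [e|ne] := eqVneq sigma pi.
  rewrite -e (big_pred1 (cuts sigma)) ?subnn ?expr0 // => S.
  by rewrite -eqEsubset eq_sym.
have [x xs xp] : exists2 x, x \in cuts sigma & x \notin cuts pi.
  apply/subsetPn; apply: contraNN ne => sub'.
  rewrite -(cutsK sBI) -(cutsK pBI); apply/eqP; congr cut_part.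
  by apply/eqP; rewrite eqEsubset sub' sub.
rewrite (bigID (fun S : {set 'I_n} => x \in S)) /=.
rewrite (reindex_onto (fun S => x |: S) (fun S => S :\ x)) /=; last first.
  by move=> S /andP[_ xS]; rewrite setD1K.
rewrite (eq_bigl (fun S : {set 'I_n} =>
   ((cuts pi \subset S) && (S \subset cuts sigma)) && (x \notin S))); last first.
  move=> S; rewrite setU11 andbT subUset sub1set xs /=.
  have -> : (x |: S) :\ x == S = (x \notin S).
    by apply/eqP/idP => [<-|/setU1K //]; rewrite !inE eqxx.
  case xS: (x \in S) => /=; rewrite ?andbF ?andbT //; congr (_ && _).
  apply/idP/idP => [/subsetP h|/subset_trans]; last by apply; exact: subsetUr.
  apply/subsetP => y yp; move: (h y yp); rewrite !inE => /orP[/eqP yx|//].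
  by rewrite -yx yp in xp.
rewrite -big_split big1 //= => S /andP[/andP[a b] xS].
rewrite cardsU1 xS add1n.
have lt : (#|S| < #|cuts sigma|)%N.
  by apply: proper_card; apply/properP; split=> //; exists x.
by rewrite -(subnSK lt) exprS mulN1r subrr.
Qed.

End Cuts.

Section Colour.
Variables (K : Type) (chi : 'I_n -> side) (omega : 'I_n -> K).

Definition BI_colour : {set {set {set 'I_n}}} :=
  [set pi in BI chi |
    [forall V in pi, forall i in V, forall j in V, `[< omega i = omega j >]]].

(* The default value is never used, see pi_omega_chiP below. *)
Definition pi_omega_chi : {set {set 'I_n}} :=
  odflt set0 [pick pi in BI_colour |
    [forall rho in BI_colour, refines pi rho ==> (rho == pi)]].

Lemma BI_colourP pi : reflect
  (pi \in BI chi /\ forall i j, j \in pblock pi i -> omega i = omega j)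
  (pi \in BI_colour).
Proof.
rewrite [pi \in BI_colour]in_set; apply: (iffP andP) => -[pBI h]; split=> //.
- move=> i j ji; apply/asboolP.
  move/forall_inP: h => /(_ _ (BI_pblock_mem i pBI))/forall_inP.
  by move=> /(_ _ (BI_mem_pblock i pBI))/forall_inP/(_ _ ji).
- apply/forall_inP => V Vpi; apply/forall_inP => i iV; apply/forall_inP => j jV.
  by apply/asboolP/h; rewrite -(BI_blockE pBI Vpi iV).
Qed.

Lemma BI_colour_max :
  exists2 pi, pi \in BI_colour & forall rho, rho \in BI_colour -> refines rho pi.
Proof.
pose D := [set i | [exists j, (chi_pos chi j == (chi_pos chi i).+1) &&
  ~~ `[< omega i = omega j >]]].
exists (cut_part chi D) => [|rho /BI_colourP[rBI rho_om]].
  apply/BI_colourP; split=> [|i j]; first exact: cut_part_BI.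
  rewrite cut_partE.
  wlog ij : i j / (chi_pos chi i <= chi_pos chi j)%N => [hw|].
    case/orP: (leq_total (chi_pos chi i) (chi_pos chi j)) => /hw // e.
    by rewrite eq_sym => /e.
  move=> /(cut_count_eqP _ ij) h.
  have [d ed] : exists d, (chi_pos chi i + d = chi_pos chi j)%N.
    by exists (chi_pos chi j - chi_pos chi i)%N; rewrite subnKC.
  elim: d j ed {ij} h => [|d IH] j ed h.
    by congr omega; apply: (@chi_pos_inj chi); rewrite -ed addn0.
  have [k ek] : exists k, chi_pos chi k = (chi_pos chi i + d)%N.
    by apply: chi_pos_surj; apply: leq_ltn_trans (chi_pos_lt chi j); rewrite -ed leq_add2l.
  have lt_kj : (chi_pos chi k < chi_pos chi j)%N by rewrite ek -ed addnS.
  rewrite (IH k) // => [|s sD si]; last exact: leq_trans (ltnW lt_kj) (h s sD si).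
  apply/asboolP; apply: contraT => kj.
  have /h : k \in D.
    by rewrite inE; apply/existsP; exists j; rewrite kj andbT ek -ed addnS.
  by rewrite ek leq_addr -ek leqNgt lt_kj => /(_ isT).
rewrite (refines_cuts rBI (cut_part_BI chi D)); apply/subsetP => i.
rewrite !inE => /forall_inP ilast; apply/forall_inP => j ji; rewrite leqNgt.
apply/negP => ij.
have [k ek] : exists k, chi_pos chi k = (chi_pos chi i).+1.
  by apply: chi_pos_surj; exact: leq_ltn_trans ij (chi_pos_lt chi j).
have [_ Ir] := BI_P _ _ rBI.
have ki : k \in pblock rho i.
  apply: (Ir _ i j k (BI_pblock_mem i rBI) (BI_mem_pblock i rBI) ji).
  by rewrite ek ij leqnSn.
have : k \in pblock (cut_part chi D) i.
  rewrite cut_partE; apply/cut_count_eqP; rewrite ek // => s.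
  rewrite leq_eqVlt inE => /existsP[l /andP[/eqP el ne]] /orP[/eqP/chi_pos_inj es|//].
  have lk : l = k by apply: (@chi_pos_inj chi); rewrite el ek es.
  by move/asboolPn: ne; rewrite -es lk; case; exact: rho_om.
by move=> /ilast; rewrite ek ltnn.
Qed.

Lemma pi_omega_chiP :
  pi_omega_chi \in BI_colour /\
  forall rho, rho \in BI_colour -> refines rho pi_omega_chi.
Proof.
have [pi piQ pimax] := BI_colour_max; have [pBI _] := BI_colourP _ piQ.
suff -> : pi_omega_chi = pi by [].
rewrite /pi_omega_chi; case: pickP => [rho /andP[rQ /forall_inP rmax]|/(_ pi)] /=.
  by move/implyP: (rmax _ piQ) => /(_ (pimax _ rQ))/eqP.
rewrite piQ => /negP[]; apply/forall_inP => rho rQ; apply/implyP => h.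
have [rBI _] := BI_colourP _ rQ.
by apply/eqP/(refines_anti rBI pBI) => //; exact: pimax.
Qed.

End Colour.

Lemma chi_blocks_sorted chi pi :
  pi \in BI chi -> sorted (block_le chi) (chi_blocks chi pi).
Proof.
move=> pBI; apply: (@sort_sorted_in _ (mem pi)); last first.
  by apply/allP => V; rewrite mem_enum.
have [_ Ip] := BI_P _ _ pBI; have tr := BI_trivIset pBI.
have half V W v w : V \in pi -> W \in pi -> V != W -> v \in V -> w \in W ->
    (chi_pos chi v < chi_pos chi w)%N ->
    [forall i in V, forall j in W, chi_lt chi i j].
  move=> VP WP VW vV wW vw.
  have disj x : x \in V -> x \in W -> False.
    move=> xV xW; case/eqP: VW.
    by rewrite (BI_blockE pBI VP xV) (BI_blockE pBI WP xW).
  apply/forall_inP => i iV; apply/forall_inP => j jW; rewrite /chi_lt /= ltnNge.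
  apply/negP => ji; have [vj|jv] := leqP (chi_pos chi v) (chi_pos chi j).
    by apply: (disj j) => //; apply: (Ip V v i j) => //; rewrite vj.
  by apply: (disj v) => //; apply: (Ip W j w v) => //; rewrite (ltnW jv) (ltnW vw).
move=> V W VP WP; have [->|VW] := eqVneq V W; first by rewrite /block_le /= eqxx.
have [v vV] := BI_block_ex pBI VP; have [w wW] := BI_block_ex pBI WP.
have [vw|wv|/chi_pos_inj e] := ltngtP (chi_pos chi v) (chi_pos chi w).
- by rewrite /block_le /= (half V W v w) ?orbT.
- by rewrite /block_le /= (half W V w v) ?orbT // eq_sym.
- case/eqP: VW; rewrite (BI_blockE pBI VP vV) (BI_blockE pBI WP wW).
  by rewrite e.
Qed.
End BiIntervals.

From mathcomp Require Import classical_sets.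
Local Open Scope classical_set_scope.

(* The B-B-non-commutative probability space (A, E, eps), which coerces to A. *)
Record bb_ncps (F : comNzRingType) (B : algType F) := BBNCPS {
  nc_alg :> algType F;
  nc_exp : {linear nc_alg -> B};
  nc_eps : {lrmorphism tensor B B^c -> nc_alg};
  nc_eps_injl : {in range (fun b : B => tens b (1 : B^c)) &, injective nc_eps};
  nc_eps_injr : {in range (fun b : B^c => tens (1 : B) b) &, injective nc_eps};
  nc_exp1 : nc_exp 1 = 1;
  nc_exp_eps : forall (b1 : B) (b2 : B^c) (Z : nc_alg),
    nc_exp (nc_eps (tens b1 b2) * Z) = b1 * nc_exp Z * (b2 : B);
  nc_exp_comm : forall (b : B) (Z : nc_alg),
    nc_exp (Z * nc_eps (tens b (1 : B^c))) =
    nc_exp (Z * nc_eps (tens (1 : B) (b : B^c)))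
}.

Section BiBoolean.
Variables (F : comNzRingType) (B : algType F) (A : bb_ncps B).

Definition eps_l (b : B) : A := nc_eps A (tens b (1 : B^c)).
Definition eps_r (b : B) : A := nc_eps A (tens (1 : B) (b : B^c)).

Definition left_alg : set A := [set Z | forall b, Z * eps_r b = eps_r b * Z].
Definition right_alg : set A := [set Z | forall b, Z * eps_l b = eps_l b * Z].

Definition subalgebra (C : set A) : Prop :=
  [/\ C 0, forall (a : F) x y, C x -> C y -> C (a *: x + y)
    & forall x y, C x -> C y -> C (x * y)].

(* Non-unital pairs of B-algebras. *)
Record pair_of_algebras (C : set A * set A) : Prop := PairOfAlgebras {
  pair_subl : subalgebra C.1;
  pair_subr : subalgebra C.2;
  pair_epsl : range eps_l `<=` C.1;
  pair_left : C.1 `<=` left_alg;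
  pair_epsr : range eps_r `<=` C.2;
  pair_right : C.2 `<=` right_alg
}.

Definition pair_side (C : set A * set A) (s : side) : set A :=
  if is_left s then C.1 else C.2.

Section Moments.
Variables (n : nat) (chi : 'I_n -> side) (Z : 'I_n -> A).

(* The product over V is taken in the usual increasing order of the indices. *)
Definition moment (pi : {set {set 'I_n}}) : B :=
  \prod_(V <- chi_blocks chi pi) nc_exp A (\prod_(i in V) Z i).

Definition bi_cumulant (pi : {set {set 'I_n}}) : B :=
  \sum_(sigma in BI chi | refines sigma pi) moment sigma *~ mu_BI sigma pi.

End Moments.

Definition bi_Boolean_independent (K : Type) (AA : K -> set A * set A) : Prop :=
  forall (n : nat) (chi : 'I_n -> side) (omega : 'I_n -> K) (Z : 'I_n -> A),
    (1 <= n)%N -> (forall j, pair_side (AA (omega j)) (chi j) (Z j)) ->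
    nc_exp A (\prod_(j < n) Z j) = moment chi Z (pi_omega_chi chi omega).

End BiBoolean.

(* Main.v *)
(* List 1, ..., n in the order <_chi, and let e a b be the expectation of the
   product of the Z_k with a <= position of k < b.  A bi-interval partition is
   given by its cuts, and its moment is the product of the e a b over consecutive
   cuts a < b.  Both sides of the equivalence say that every word splits at every
   colour change c, that is e 0 n = e 0 c * e c n.
   For the cumulants: when every shorter word splits at c, adding or removing the
   cut c changes the sign of mu_BI but not the moment, except for the one-block
   partition, so that B_{1_chi} = e 0 n - e 0 c * e c n.
   For independence: the cuts of pi_{omega,chi} are exactly the colour changes,
   so splitting at them one after the other gives the moment of pi_{omega,chi};
   conversely, regroup this moment at c and apply the result to the two halves,
   which are shorter. *)
Require Import Defs.
From mathcomp Require Import all_boot all_order all_algebra.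
From mathcomp Require Import boolp classical_sets reals complex.
From mathcomp Require Import zify.

Set Implicit Arguments.
Unset Strict Implicit.
Unset Printing Implicit Defensive.

Import GRing.Theory.
Local Open Scope ring_scope.

Local Notation pblock := finset.pblock.

(** * Products over consecutive cuts *)

Section CutProducts.
Variables (B : pzRingType) (e : nat -> nat -> B).

Fixpoint cut_prod (a : nat) (l : seq nat) : B :=
  if l is c :: l' then e a c * cut_prod c l' else 1.

Lemma cut_prod_cat a l1 l2 :
  cut_prod a (l1 ++ l2) = cut_prod a l1 * cut_prod (last a l1) l2.
Proof. by elim: l1 a => [|c l1 IH] a /=; rewrite ?mul1r // IH mulrA. Qed.

(** Cuts are absorbed from the right: by induction the part after the first cut [c] collapses to
    [e c n], and splitting at [c] merges it with [e a c]. The right end is always [n], while the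
    left end varies so that the hypothesis passes to tails. *)
Lemma cut_prod_telescope a l n :
  path ltn a l -> last a l = n -> l != [::] ->
  (forall a' c, (a <= a' < c)%N -> (c < n)%N -> c \in l ->
    e a' n = e a' c * e c n) ->
  cut_prod a l = e a n.
Proof.
elim: l a => [//|c [|d l] IH] a; first by move=> _ /= ->; rewrite mulr1.
rewrite [path _ _ _]/= -/(path ltn c (d :: l)) => /andP[ac cdl] ln _ esplit.
have cn : (c < n)%N.
  have /allP := order_path_min ltn_trans cdl; apply.
  by rewrite -ln /= mem_last.
have -> : cut_prod a [:: c, d & l] = e a c * cut_prod c (d :: l) by [].
rewrite (IH c cdl ln) // => [|a' c' /andP[ca a'c] c'n c'l].
  by rewrite [RHS](esplit a c) ?mem_head ?leqnn.
by rewrite (esplit a' c') ?[_ \in c :: _]inE ?c'l ?orbT // a'c (leq_trans (ltnW ac)).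
Qed.

End CutProducts.

(** * Sets of cuts as increasing sequences of numbers *)

Section CutSequences.
Variables (n : nat) (chi : 'I_n -> side).
Implicit Types (S : {set 'I_n}) (pi : {set {set 'I_n}}).
Notation pos := (chi_pos chi).

Lemma chi_enum_uniq : uniq (chi_enum chi).
Proof. by rewrite (perm_uniq (perm_chi_enum chi)) enum_uniq. Qed.

Lemma map_chi_pos : [seq pos i | i <- chi_enum chi] = iota 0 n.
Proof.
apply: (@eq_from_nth _ 0%N) => [|k]; rewrite size_map size_chi_enum ?size_iota //.
move=> kn; rewrite (nth_map (Ordinal kn)) ?size_chi_enum // nth_iota //.
by rewrite /chi_pos index_uniq ?size_chi_enum // chi_enum_uniq.
Qed.

Lemma chi_pos_head s i t : chi_enum chi = s ++ i :: t -> pos i = size s.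
Proof.
move=> e; have := chi_enum_uniq; rewrite /chi_pos e cat_uniq index_cat => /and3P[_].
by rewrite /= negb_or => /andP[/negPf-> _] _; rewrite eqxx addn0.
Qed.

(* The cut after an element is recorded as the number of elements up to it. *)
Definition cut_seq S : seq nat := [seq (pos s).+1 | s <- chi_enum chi & s \in S].

Lemma cut_seq_sorted S : sorted ltn (cut_seq S).
Proof.
apply: (subseq_sorted ltn_trans (map_subseq _ (filter_subseq _ _))).
rewrite (map_comp succn pos) map_chi_pos.
by rewrite -[X in sorted _ X]/(map (addn 1) _) -iotaDl iota_ltn_sorted.
Qed.

Lemma mem_cut_seq S i : ((pos i).+1 \in cut_seq S) = (i \in S).
Proof.
rewrite mem_map ?mem_filter ?mem_chi_enum ?andbT //.
by move=> x y [] /chi_pos_inj.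
Qed.

Lemma cut_seqP S c : reflect (exists2 i, i \in S & c = (pos i).+1) (c \in cut_seq S).
Proof.
apply: (iffP mapP) => [[j] | [j jS ->]]; last by exists j; rewrite ?mem_filter ?jS ?mem_chi_enum.
by rewrite mem_filter => /andP[jS _] ->; exists j.
Qed.

Lemma cut_seq_le S c : c \in cut_seq S -> (c <= n)%N.
Proof. by move=> /cut_seqP[i _ ->]; exact: chi_pos_lt. Qed.

Lemma size_cut_seq S : size (cut_seq S) = #|S|.
Proof.
rewrite size_map cardE size_filter (permP (perm_chi_enum chi)) -size_filter.
by rewrite [enum _ in LHS]enumT.
Qed.

Lemma cut_seqU1 x S : x \notin S -> exists l1 l2,
  cut_seq S = l1 ++ l2 /\ cut_seq (x |: S) = l1 ++ (pos x).+1 :: l2.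
Proof.
move=> xS; have := chi_enum_uniq; have := mem_chi_enum chi x.
rewrite /cut_seq; move=> /splitPr[s t]; rewrite cat_uniq => /and3P[_ + xt].
rewrite /= negb_or => /andP[xs _].
have {}xt : x \notin t by case/andP: xt.
exists [seq (pos s).+1 | s <- s & s \in S], [seq (pos s).+1 | s <- t & s \in S].
rewrite !filter_cat !map_cat /= (negPf xS) setU11 /=; split=> //.
have eqf r : x \notin r -> [seq s <- r | s \in x |: S] = [seq s <- r | s \in S].
  move=> xr; apply: eq_in_filter => y yr; rewrite !inE.
  by case: eqP => // yx; rewrite -yx yr in xr.
by rewrite !eqf.
Qed.

Lemma cut_seq_rcons S : (0 < n)%N -> (forall i, (pos i).+1 = n -> i \in S) ->
  exists l, cut_seq S = rcons l n.
Proof.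
have := size_chi_enum chi; have := chi_pos_head; rewrite /cut_seq.
case/lastP: (chi_enum chi) => [|s i]; first by move=> _ sz; rewrite -{1}sz.
rewrite size_rcons -cats1.
move=> /(_ s i [::] erefl) pi sn _ Sl; have pn : (pos i).+1 = n by rewrite pi.
by rewrite filter_cat map_cat /= Sl //= pn cats1; eexists.
Qed.

End CutSequences.

(** * Moments of bi-interval partitions as products over cuts *)

Section Moments.
Variables (F : comNzRingType) (B : algType F) (A : bb_ncps B).

(** The positions for the chi-order only select the factors; these are still multiplied in the usual
    order of the indices, as in [moment]. *)
Definition interval_exp n (chi : 'I_n -> side) (Z : 'I_n -> A) (a b : nat) : B :=
  nc_exp A (\prod_(i | (a <= chi_pos chi i < b)%N) Z i).

Lemma interval_exp_full n (chi : 'I_n -> side) (Z : 'I_n -> A) :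
  interval_exp chi Z 0 n = nc_exp A (\prod_i Z i).
Proof. by congr (nc_exp A _); apply: eq_bigl => i; rewrite chi_pos_lt. Qed.

Section Partition.
Variables (n : nat) (chi : 'I_n -> side) (pi : {set {set 'I_n}}).
Hypothesis piBI : pi \in BI chi.
Notation pos := (chi_pos chi).

Lemma cut_pblock_le s i : s \in cuts chi pi -> i \in pblock pi s -> (pos i <= pos s)%N.
Proof. by rewrite inE => /forall_inP sc; exact: sc. Qed.

(** If some [j] in the block of [t] did not come after some [i] in the block of [s], then [s] would
    lie between [j] and [t], hence in the block of [t], and [t] would lie past the last element of
    its own block. *)
Lemma pblock_cut_lt s t : s \in cuts chi pi -> t \in cuts chi pi ->
  (pos s < pos t)%N -> block_le chi (pblock pi s) (pblock pi t).
Proof.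
move=> sc tc st; apply/orP; right; apply/forall_inP => i si.
apply/forall_inP => j tj; rewrite /chi_lt /= ltnNge; apply/negP => ji.
have [_ ivl] := BI_P _ _ piBI; have tr := BI_trivIset piBI.
have ts : s \in pblock pi t.
  apply: (ivl _ j t s (BI_pblock_mem t piBI)) => //; first exact: BI_mem_pblock piBI.
  by rewrite (leq_trans ji (cut_pblock_le sc si)) ltnW.
have := @cut_pblock_le s t sc; rewrite (same_pblock tr ts) (BI_mem_pblock t piBI).
by rewrite leqNgt st => /(_ isT).
Qed.

(** Both lists enumerate the blocks once and are sorted for [block_le]. That relation is transitive
    and antisymmetric only on non-empty sets, so uniqueness of sorted lists is applied relative to
    the blocks. *)
Lemma chi_blocks_cuts :
  chi_blocks chi pi = [seq pblock pi s | s <- chi_enum chi & s \in cuts chi pi].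
Proof.
have strict (V W : {set 'I_n}) i j : i \in V -> j \in W -> block_le chi V W ->
    V = W \/ (pos i < pos j)%N.
  move=> iV jW /orP[/eqP|/forall_inP/(_ i iV)/forall_inP/(_ j jW)]; first by left.
  by right.
have sub : {subset chi_blocks chi pi <= pi} by move=> V; rewrite mem_sort mem_enum.
apply: (@sorted_eq_in _ (block_le chi)).
- move=> W V U /sub Wp /sub Vp /sub Up VW WU.
  have [j jW] := BI_block_ex piBI Wp.
  case: (eqVneq V W) VW => [-> //|VW] /orP[/eqP e|/forall_inP lVW]; first by rewrite e eqxx in VW.
  case: (eqVneq W U) WU => [<- _|WU]; first by apply/orP; right; apply/forall_inP.
  move=> /orP[/eqP e|/forall_inP lWU]; first by rewrite e eqxx in WU.
  apply/orP; right; apply/forall_inP => i iV; apply/forall_inP => k kU.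
  move/forall_inP: (lVW i iV) => /(_ j jW); move/forall_inP: (lWU j jW) => /(_ k kU).
  by move=> jk ij; exact: ltn_trans ij jk.
- move=> V W /sub Vp /sub Wp /andP[VW WV].
  have [i iV] := BI_block_ex piBI Vp; have [j jW] := BI_block_ex piBI Wp.
  have [//|ij] := strict V W i j iV jW VW.
  by have [//|] := strict W V j i jW iV WV; rewrite ltnNge ltnW.
- exact: chi_blocks_sorted.
- rewrite sorted_map.
  have: sorted (relpre pos ltn) [seq s <- chi_enum chi | s \in cuts chi pi].
    have := cut_seq_sorted chi (cuts chi pi).
    by rewrite -sorted_map /cut_seq (map_comp succn pos) sorted_map.
  apply: (@sub_in_sorted _ (mem (cuts chi pi))); last exact: filter_all.
  by move=> s t sc tc; exact: pblock_cut_lt.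
- apply: uniq_perm.
  + by rewrite sort_uniq enum_uniq.
  + rewrite map_inj_in_uniq ?filter_uniq ?chi_enum_uniq // => s t.
    rewrite !mem_filter => /andP[sc _] /andP[tc _] st; apply: (@chi_pos_inj n chi).
    apply/eqP; rewrite eqn_leq cut_pblock_le -?st ?(BI_mem_pblock _ piBI) //.
    by rewrite (@cut_pblock_le s) ?st ?(BI_mem_pblock _ piBI).
  + move=> V; rewrite mem_sort mem_enum; apply/idP/mapP => [Vp|[s _ ->]]; last first.
      exact: BI_pblock_mem piBI.
    have [i iV] := BI_block_ex piBI Vp; have [m mV mmax] := arg_maxnP pos iV.
    have Vm := BI_blockE piBI Vp mV; exists m => //.
    by rewrite mem_filter mem_chi_enum andbT inE -Vm; apply/forall_inP => k; exact: mmax.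
Qed.

Lemma moment_cut_prod (Z : 'I_n -> A) :
  moment chi Z pi = cut_prod (interval_exp chi Z) 0 (cut_seq chi (cuts chi pi)).
Proof.
rewrite /moment chi_blocks_cuts big_map big_filter /cut_seq.
(* Invariant of the scan: [a] is the prefix already read, [c] is 0 or the last cut met, and no cut
   lies between [c] and the end of [a]. Thus the block ending at the next cut [h] occupies exactly
   the positions from [c] to that of [h]. *)
have prefixP a c t : chi_enum chi = a ++ t -> (c <= size a)%N ->
    (forall s, s \in cuts chi pi -> (c <= pos s)%N -> (size a <= pos s)%N) ->
    (c = 0%N \/ exists2 s, s \in cuts chi pi & c = (pos s).+1) ->
    \prod_(s <- t | s \in cuts chi pi) nc_exp A (\prod_(i in pblock pi s) Z i) =
    cut_prod (interval_exp chi Z) c [seq (pos s).+1 | s <- t & s \in cuts chi pi].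
  elim: t a c => [|h t IH] a c ea ca no_cut c_cut; first by rewrite big_nil.
  have ph := chi_pos_head ea; rewrite -cat_rcons in ea.
  rewrite big_cons /=; case: ifPn => hc /=; last first.
    apply: (IH _ c ea) => //; first by rewrite size_rcons (leq_trans ca).
    move=> s sc /(no_cut s sc); rewrite size_rcons leq_eqVlt => /orP[/eqP e|//].
    by case/negP: hc; rewrite (_ : h = s) //; apply: (@chi_pos_inj n chi); rewrite ph e.
  rewrite (IH _ (pos h).+1 ea) ?size_rcons ?ph // => [|]; last by right; exists h; rewrite ?ph.
  congr (nc_exp A _ * _); apply: eq_bigl => i.
  rewrite ltnS -ph (mem_pblock_cuts _ _ piBI); apply/idP/idP.
    move=> hi; rewrite (@cut_pblock_le h) ?(mem_pblock_cuts _ _ piBI) // andbT.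
    case: c_cut => [-> //|[s sc cs]]; rewrite cs; rewrite ltnNge; apply/negP => i_s.
    have ih : (pos i <= pos h)%N by rewrite (@cut_pblock_le h) ?(mem_pblock_cuts _ _ piBI).
    move: hi; rewrite eq_sym => /(cut_count_eqP _ ih)/(_ s sc i_s).
    by move: ca; rewrite cs -ph; lia.
  move=> /andP[ci ih]; rewrite eq_sym; apply/(cut_count_eqP _ ih) => s sc i_s.
  by rewrite ph; apply: no_cut => //; exact: leq_trans ci i_s.
by apply: (prefixP [::]) => //; left.
Qed.

End Partition.
End Moments.

(** * Restriction of a word to a subset, then to a chi-interval *)

Section Restriction.
Variables (n : nat) (chi : 'I_n -> side) (V : {set 'I_n}).

Definition restr (T : Type) (g : 'I_n -> T) (i : 'I_#|V|) : T := g (enum_val i).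

Lemma map_enum_val : [seq enum_val i | i <- enum 'I_#|V|] = [seq i <- enum 'I_n | i \in V].
Proof.
transitivity (enum V); last by rewrite [enum 'I_n]enumT.
have [|[x xV]] := set_0Vmem V.
  move=> V0; rewrite (_ : enum V = [::]); last by rewrite V0 enum_set0.
  by apply/size0nil; rewrite size_map size_enum_ord V0 cards0.
apply: (@eq_from_nth _ x) => [|k]; rewrite size_map size_enum_ord ?cardE //.
move=> kV; rewrite (nth_map (Ordinal kV)) ?size_enum_ord // (enum_val_nth x).
by rewrite nth_enum_ord.
Qed.

(** [enum_val] is increasing, so renumbering respects both the left half and the reversed right half
    of the chi-order. *)
Lemma chi_enum_restr :
  [seq i <- chi_enum chi | i \in V] = [seq enum_val i | i <- chi_enum (restr chi)].
Proof.
have swap a : [seq i <- [seq i <- enum 'I_n | a (chi i)] | i \in V] =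
    [seq enum_val i | i <- enum 'I_#|V| & a (restr chi i)].
  rewrite -(filter_map enum_val (fun i => a (chi i))) map_enum_val -!filter_predI.
  by apply: eq_filter => i /=; rewrite [(i \in V) && _]andbC.
rewrite /chi_enum filter_cat filter_rev map_cat map_rev.
by rewrite (swap Defs.is_left) (swap (fun s => ~~ Defs.is_left s)).
Qed.

Lemma prod_restr (R : pzSemiRingType) (P : pred 'I_#|V|) (Q : pred 'I_n) (Z : 'I_n -> R) :
  (forall i, P i = Q (enum_val i)) ->
  \prod_(i | P i) restr Z i = \prod_(i | (i \in V) && Q i) Z i.
Proof.
have enumE (T : finType) : index_enum T = enum T by rewrite enumT [index_enum T]unlock.
move=> PQ; rewrite !enumE -big_filter_cond -map_enum_val big_map; exact: eq_bigl.
Qed.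

End Restriction.

Section Subinterval.
Variables (n : nat) (chi : 'I_n -> side) (a b : nat).
Hypotheses (ab : (a <= b)%N) (bn : (b <= n)%N).

Definition chi_segment : {set 'I_n} := [set i | (a <= chi_pos chi i < b)%N].
Notation V := chi_segment.

Lemma chi_pos_segment_enum :
  [seq chi_pos chi i | i <- chi_enum chi & i \in V] = iota a (b - a).
Proof.
rewrite (eq_filter (a2 := preim (chi_pos chi) (fun k => a <= k < b)%N)); last first.
  by move=> i; rewrite inE.
rewrite -filter_map map_chi_pos.
have -> : n = (a + ((b - a) + (n - b)))%N by lia.
rewrite !iotaD !filter_cat.
rewrite (eq_in_filter (a2 := pred0)) ?filter_pred0; last by move=> k; rewrite mem_iota /=; lia.
rewrite (eq_in_filter (a2 := predT)) ?filter_predT; last by move=> k; rewrite mem_iota /=; lia.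
rewrite (eq_in_filter (a2 := pred0)) ?filter_pred0 ?cats0 //; by move=> k; rewrite mem_iota /=; lia.
Qed.

Lemma card_chi_segment : #|V| = (b - a)%N.
Proof.
rewrite -(size_chi_enum (restr chi)) -(size_iota a (b - a)).
by rewrite -chi_pos_segment_enum chi_enum_restr !size_map.
Qed.

Lemma chi_pos_restr (i : 'I_#|V|) :
  chi_pos chi (enum_val i) = (a + chi_pos (restr chi) i)%N.
Proof.
have := chi_pos_lt (restr chi) i; rewrite {2}card_chi_segment => lt_i.
rewrite -(nth_iota 0%N a lt_i) -chi_pos_segment_enum chi_enum_restr.
rewrite -map_comp (nth_map i) ?size_chi_enum ?chi_pos_lt //=.
by rewrite /chi_pos nth_index ?mem_chi_enum.
Qed.

(** Renumbering a segment shifts positions by [a]; the bound on [q] keeps all selected factors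
    inside the segment. *)
Lemma interval_exp_restr (F : comNzRingType) (B : algType F) (A : bb_ncps B) (Z : 'I_n -> A) p q :
  (q <= b - a)%N ->
  interval_exp (restr (V := V) chi) (restr (V := V) Z) p q = interval_exp chi Z (a + p) (a + q).
Proof.
move=> qb; congr (nc_exp A _).
rewrite (@prod_restr _ _ _ _ (fun i : 'I_n => (a + p <= chi_pos chi i < a + q)%N)); last first.
  by move=> i; rewrite chi_pos_restr !leq_add2l ltn_add2l.
by apply: eq_bigl => i; rewrite inE; lia.
Qed.

End Subinterval.

(** * Colour changes are the inner cuts of the maximal monochromatic partition *)

Section ColourChanges.
Variables (n : nat) (K : Type) (chi : 'I_n -> side) (omega : 'I_n -> K).
Notation pos := (chi_pos chi).

(** As in [cut_seq], [c] counts the elements before the change, so it is also the position of the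
    first element after it. *)
Definition colour_change (c : nat) : Prop :=
  exists i j, [/\ (pos i).+1 = c, pos j = c & omega i <> omega j].

Lemma colour_change_lt c : colour_change c -> (0 < c < n)%N.
Proof. by move=> [s [t [<- st _]]]; rewrite /= -st chi_pos_lt. Qed.

(** Without any change neighbours share their colour, and induction on the distance makes the
    colouring constant. *)
Lemma colour_change_ex :
  ~ (forall i j, omega i = omega j) -> exists c, colour_change c.
Proof.
apply: contra_notP => /forallNP no_change.
have shift d s t : pos t = (pos s + d)%N -> omega s = omega t.
  elim: d t => [|d IH] t ts; first by congr omega; apply: (@chi_pos_inj n chi); rewrite ts addn0.
  have [r rs] : exists r, pos r = (pos s + d)%N.
    by apply: chi_pos_surj; apply: leq_ltn_trans (chi_pos_lt chi t); rewrite ts leq_add2l.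
  rewrite (IH r rs); apply: contrapT => rt; apply: (no_change (pos t)).
  by exists r, t; split=> //; rewrite rs ts addnS.
move=> s t; case/orP: (leq_total (pos s) (pos t)) => st.
  by apply: (shift (pos t - pos s)%N); rewrite subnKC.
by apply/esym/(shift (pos s - pos t)%N); rewrite subnKC.
Qed.

Lemma pi_omega_chi_change c : (c < n)%N ->
  c \in cut_seq chi (cuts chi (pi_omega_chi chi omega)) -> colour_change c.
Proof.
have [piQ pimax] := pi_omega_chiP chi omega.
move: (pi_omega_chi chi omega) piQ pimax => pi /BI_colourP[piBI pi_om] pimax.
move=> cn /cut_seqP[s sc cE]; have [t tc] := chi_pos_surj chi cn.
exists s, t; split=> // st.
(* If both sides of the cut [s] had the same colour, erasing [s] would leave a monochromatic
   partition, against the maximality of [pi]. *)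
pose rho := cut_part chi (cuts chi pi :\ s).
have rBI : rho \in BI chi by exact: cut_part_BI.
have : rho \in BI_colour chi omega.
  apply/BI_colourP; split=> // k l.
  rewrite cut_partE; wlog kl : k l / (pos k <= pos l)%N => [hw|].
    case/orP: (leq_total (pos k) (pos l)) => /hw // e.
    by rewrite eq_sym => /e.
  move=> /(cut_count_eqP _ kl) no_cut.
  have {}no_cut u : u \in cuts chi pi -> u != s -> (pos k <= pos u)%N -> (pos l <= pos u)%N.
    by move=> uc us; apply: no_cut; rewrite in_setD1 us.
  (* If [s] separates [k] from [l], the colour is carried from [k] to [s] and from [t] to [l] inside
     blocks of [pi], and across the erased cut by [st]. Otherwise [k] and [l] already share a block
     of [pi]. *)
  have [/andP[ks sl]|ksl] := boolP (pos k <= pos s < pos l)%N.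
    rewrite (pi_om k s); last first.
      rewrite (mem_pblock_cuts _ _ piBI); apply/(cut_count_eqP _ ks) => u uc ku.
      have [-> //|us] := eqVneq u s.
      by rewrite (leq_trans (ltnW sl)) // no_cut.
    have tl : (pos t <= pos l)%N by rewrite tc cE.
    rewrite st (pi_om t l) // (mem_pblock_cuts _ _ piBI); apply/(cut_count_eqP _ tl) => u uc tu.
    apply: no_cut => //; last by lia.
    by apply: contraTneq tu => ->; rewrite tc cE ltnn.
  apply: pi_om; rewrite (mem_pblock_cuts _ _ piBI); apply/(cut_count_eqP _ kl) => u uc ku.
  have [us|us] := eqVneq u s; last exact: no_cut.
  by move: ksl ku; rewrite us; lia.
move=> /pimax; rewrite (refines_cuts rBI piBI) cut_partK => [/fintype.subsetP/(_ s sc)|u un].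
  by rewrite !inE eqxx.
(* As [c < n], the erased cut is not the compulsory one at the end of the word. *)
rewrite in_setD1 (cuts_last _ un) andbT.
by apply: contraTneq cn => us; rewrite cE -us un ltnn.
Qed.

(** If the block of [s] went on past [s], it would contain the next element [t], which has another
    colour. *)
Lemma colour_change_cut c : colour_change c ->
  c \in cut_seq chi (cuts chi (pi_omega_chi chi omega)).
Proof.
have [/BI_colourP[piBI pi_om] _] := pi_omega_chiP chi omega.
move=> [s [t [<- tc st]]]; rewrite mem_cut_seq inE; apply/forall_inP => k ks.
rewrite leqNgt; apply/negP => sk; case: st; apply: pi_om.
have [_ ivl] := BI_P _ _ piBI.
apply: (ivl _ s k t (BI_pblock_mem s piBI)) => //; first exact: BI_mem_pblock piBI.
by rewrite tc leqnSn.
Qed.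

End ColourChanges.

(** * The cumulant as a splitting defect *)

Section CumulantSplit.
Variables (F : comNzRingType) (B : algType F) (A : bb_ncps B).
Variables (n : nat) (chi : 'I_n -> side) (Z : 'I_n -> A).
Notation pos := (chi_pos chi).
Notation e := (interval_exp chi Z).

Lemma cut_part_last_cut (S : {set 'I_n}) m : (pos m).+1 = n -> m \in S ->
  cuts chi (cut_part chi S) = S.
Proof.
move=> mn mS; apply: cut_partK => s sn; rewrite (_ : s = m) //.
by apply: (@chi_pos_inj n chi); apply/succn_inj; rewrite sn mn.
Qed.

(** Bi-interval partitions correspond bijectively to the sets of cuts that contain the last element
    [m]. *)
Lemma bi_cumulant_cuts m : (pos m).+1 = n ->
  bi_cumulant chi Z (one_chi n) =
  \sum_(S : {set 'I_n} | m \in S) cut_prod e 0 (cut_seq chi S) *~ (-1) ^+ (#|S| - 1).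
Proof.
move=> mn; rewrite /bi_cumulant (reindex_onto (cut_part chi) (cuts chi)) /=; last first.
  by move=> pi /andP[/cutsK].
apply: eq_big => [S|S mS].
  have -> : refines (cut_part chi S) (one_chi n).
    apply/forall_inP => V _; apply/exists_inP; exists (finset.setTfor 'I_n); first exact: set11.
    exact: finset.subsetT.
  rewrite cut_part_BI /=; apply/eqP/idP => [<-|]; first exact: cuts_last.
  exact: cut_part_last_cut.
have {}mS : m \in S by case/andP: mS => _ /eqP <-; exact: cuts_last.
rewrite (moment_cut_prod (cut_part_BI chi S)) /mu_BI -(card_cuts (cut_part_BI chi S)).
by rewrite (cut_part_last_cut mn mS) cards1.
Qed.

(** The new cut is not the last one, since [m] is in [S], so it falls strictly between 0 or an old
    cut and a next cut [b]. A further cut in [S] makes this gap shorter than the whole word. *)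
Lemma cut_seqU1_between x m (S : {set 'I_n}) :
  (pos m).+1 = n -> m \in S -> x \notin S ->
  exists l1 b l2, [/\ cut_seq chi S = l1 ++ b :: l2,
    cut_seq chi (x |: S) = l1 ++ (pos x).+1 :: b :: l2,
    (last 0 l1 < (pos x).+1 < b)%N, (b <= n)%N &
    S != [set m]%SET -> (b - last 0 l1 < n)%N].
Proof.
move=> mn mS xS; have [l1 [l2 [eS exS]]] := cut_seqU1 chi xS.
have last_in s : (pos s).+1 = n -> s \in x |: S.
  move=> sn; rewrite (_ : s = m) ?inE ?mS ?orbT //.
  by apply: (@chi_pos_inj n chi); apply/succn_inj; rewrite sn mn.
have n0 : (0 < n)%N by rewrite -mn.
have [l el] := cut_seq_rcons n0 last_in.
have xm : (pos x).+1 != n.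
  apply: contraNneq xS => xn; rewrite (_ : x = m) //.
  by apply: (@chi_pos_inj n chi); apply/succn_inj; rewrite xn mn.
case: l2 => [|b l2] in eS exS.
  by case/negP: xm; have /(congr1 (last 0%N)) := el; rewrite exS last_rcons last_cat /= => ->.
exists l1, b, l2; have bn : (b <= n)%N.
  by apply: (@cut_seq_le _ chi S); rewrite eS mem_cat mem_head orbT.
have := cut_seq_sorted chi (x |: S); rewrite exS sorted_cat_cons => /andP[l1x /= /andP[xb bl2]].
split=> //.
  by rewrite xb andbT; case: l1 l1x {eS exS} => //= a l1; rewrite rcons_path => /andP[].
(* Without other cuts [S] is the singleton of [m]; a cut after [b] gives [b < n]; a cut before [x]
   makes the left end positive. *)
move=> {exS l1x} Sm; case: l1 l2 => [|a l1] [|d l2] /= in eS bl2 *.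
- case/negP: Sm; have /eqP/cards1P[u Su] : #|S| = 1%N by rewrite -(size_cut_seq chi) eS.
  by move: mS; rewrite Su inE => /eqP ->.
- have dn : (d <= n)%N by apply: (@cut_seq_le _ chi S); rewrite eS !inE eqxx !orbT.
  by case/andP: bl2 => bd _; rewrite subn0 (leq_trans bd).
all: have /cut_seqP[u _ ->] : last a l1 \in cut_seq chi S by rewrite eS -cat_cons mem_cat mem_last.
all: by lia.
Qed.

Lemma bi_cumulant_split x :
  ((pos x).+1 < n)%N ->
  (forall a b, (a < (pos x).+1 < b)%N -> (b <= n)%N -> (b - a < n)%N ->
    e a b = e a (pos x).+1 * e (pos x).+1 b) ->
  bi_cumulant chi Z (one_chi n) = e 0 n - e 0 (pos x).+1 * e (pos x).+1 n.
Proof.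
move=> xn esplit; have [m mn] : exists m, (pos m).+1 = n.
  have [|m mE] := @chi_pos_surj n chi n.-1; first by lia.
  by exists m; rewrite mE; lia.
have xm : x != m by apply: contraTneq xn => ->; rewrite mn ltnn.
rewrite (bi_cumulant_cuts mn) (bigID (fun S : {set 'I_n} => x \in S)) /=.
(* Each set containing [x] is paired with the same set without [x]. *)
rewrite (reindex_onto (fun S => x |: S) (fun S => (S :\ x)%SET)) /=; last first.
  by move=> S /andP[_ xS]; rewrite finset.setD1K.
rewrite [X in X + _](eq_bigl (fun S : {set 'I_n} => (m \in S) && (x \notin S))); last first.
  move=> S; rewrite in_setU1 setU11 andbT eq_sym (negPf xm) /=; congr (_ && _).
  by apply/eqP/idP => [<-|/setU1K //]; rewrite !inE eqxx.
rewrite -big_split (bigD1 [set m]%SET) /=; last by rewrite !inE eqxx xm.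
rewrite big1 ?addr0 => [|S /andP[/andP[mS xS] Sm]].
  (* The singleton of [m] is the only pair whose gap is the whole word; it contributes the
     right-hand side. Having size 1, its cut sequence forces [l1] and [l2] to be empty and
     [b = n]. *)
  have := cut_seqU1_between mn (set11 m) (x := x).
  rewrite inE xm => /(_ isT)[l1 [b [l2 [eS exS _ _ _]]]].
  have := size_cut_seq chi [set m]; rewrite cards1 exS eS.
  have := mem_cut_seq chi [set m] m; rewrite inE eqxx mn eS.
  case: l1 {eS exS} => [|a [|a' l1]] //; case: l2 => //=.
  rewrite inE => /eqP <- _; rewrite cardsU1 inE xm cards1 /= !mulr1.
  by rewrite expr0 expr1 mulr1z mulrN1z addrC.
(* In every other pair the gap is short, so both moments agree by [esplit]. The signs are opposite:
   [S] is non-empty, which keeps the truncated subtraction exact. *)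
have [l1 [b [l2 [-> -> /andP[lx xb] bn bl]]]] := cut_seqU1_between mn mS xS.
rewrite !cut_prod_cat /= (esplit (last 0 l1) b) ?lx ?bl // mulrA.
have S0 : (0 < #|S|)%N by rewrite card_gt0; apply/set0Pn; exists m.
rewrite cardsU1 xS add1n subn1 /= -(subnK S0) addnK exprD expr1 mulrN1 mulrNz.
by rewrite !mulrA addNr.
Qed.

End CumulantSplit.

(** * Independence and splitting at colour changes *)

Section Independence.
Variables (F : comNzRingType) (B : algType F) (A : bb_ncps B).
Variables (K : Type) (AA : K -> set A * set A).

Definition adapted n (chi : 'I_n -> side) (omega : 'I_n -> K) (Z : 'I_n -> A) : Prop :=
  forall j, pair_side (AA (omega j)) (chi j) (Z j).

Definition splits_at_changes (n : nat) : Prop :=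
  forall (chi : 'I_n -> side) (omega : 'I_n -> K) (Z : 'I_n -> A),
    adapted chi omega Z -> forall c, colour_change chi omega c ->
    interval_exp chi Z 0 n = interval_exp chi Z 0 c * interval_exp chi Z c n.

(** The segment from [a] to [b] is itself an adapted word of length [b - a], with a colour change at
    [c - a]. *)
Lemma interval_exp_split n (chi : 'I_n -> side) (omega : 'I_n -> K) (Z : 'I_n -> A) a c b :
  adapted chi omega Z -> colour_change chi omega c ->
  (a < c < b)%N -> (b <= n)%N -> splits_at_changes (b - a) ->
  interval_exp chi Z a b = interval_exp chi Z a c * interval_exp chi Z c b.
Proof.
move=> adZ [s [t [sc tc st]]] /andP[ac cb] bn.
have ab : (a <= b)%N by lia.
pose V := chi_segment chi a b; have cV : #|V| = (b - a)%N := card_chi_segment chi ab bn.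
(* The two elements around the change have positions [c - 1] and [c], both inside the segment, and
   are lifted to it. *)
have lift u : (a <= chi_pos chi u < b)%N -> exists2 u' : 'I_#|V|,
    enum_val u' = u & (a + chi_pos (restr (V := V) chi) u' = chi_pos chi u)%N.
  move=> uV; have uV' : u \in V by rewrite inE.
  exists (enum_rank_in uV' u); first by rewrite enum_rankK_in.
  by rewrite -chi_pos_restr // enum_rankK_in.
have [|s' es ps] := lift s; first by lia.
have [|t' et pt] := lift t; first by lia.
rewrite -cV => /(_ (restr chi) (restr omega) (restr Z)) split_V.
have := split_V (fun j => adZ (enum_val j)) (c - a)%N.
rewrite !interval_exp_restr ?cV; try lia.
rewrite addn0 subnKC ?(ltnW ac) // (_ : a + #|V| = b)%N; [apply | lia].
by exists s', t'; split; [lia | lia | rewrite /restr es et].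
Qed.

Lemma splits_at_changes_indep :
  (forall n, splits_at_changes n) -> bi_Boolean_independent AA.
Proof.
move=> splits n chi omega Z n0 adZ.
have [/BI_colourP[piBI _] _] := pi_omega_chiP chi omega.
rewrite -(interval_exp_full chi) (moment_cut_prod piBI); apply/esym.
have [l el] := cut_seq_rcons n0 (cuts_last (chi := chi) (pi_omega_chi chi omega)).
have := cut_seq_sorted chi (cuts chi (pi_omega_chi chi omega)).
have change := @pi_omega_chi_change _ _ chi omega; rewrite el in change *.
move=> sl; apply: cut_prod_telescope.
(* Every cut is a successor, so 0 can precede the sorted sequence. *)
- have := @cut_seqP _ chi (cuts chi (pi_omega_chi chi omega)); rewrite el.
  by case: (rcons l n) sl => //= d l' -> /(_ d)/[!mem_head]/elimT[//|u _ ->].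
- by rewrite last_rcons.
- by case: (l).
- move=> a c /andP[_ ac] cn cl.
  by apply: (interval_exp_split adZ (change c cn cl)); rewrite ?ac ?cn.
Qed.

Lemma indep_splits_at_changes :
  bi_Boolean_independent AA -> forall n, splits_at_changes n.
Proof.
move=> indep n; elim/ltn_ind: n => n IH chi omega Z adZ c ch.
have /andP[c0 cn] := colour_change_lt ch.
have n0 : (0 < n)%N by lia.
have [/BI_colourP[piBI _] _] := pi_omega_chiP chi omega.
rewrite interval_exp_full (indep _ _ _ _ n0 adZ) (moment_cut_prod piBI).
have := cut_seq_sorted chi (cuts chi (pi_omega_chi chi omega)).
have := colour_change_cut ch.
have change := @pi_omega_chi_change _ _ chi omega.
have [l el] := cut_seq_rcons n0 (cuts_last (chi := chi) (pi_omega_chi chi omega)).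
have := congr1 (last 0%N) el; rewrite last_rcons.
have := @cut_seqP _ chi (cuts chi (pi_omega_chi chi omega)).
move: (cut_seq _ _) change => {el} L change LP; move=> + cL.
case/splitPr: cL change LP => l1 l2 change LP.
rewrite last_cat /= -cat_rcons => ln.
rewrite cat_rcons sorted_cat_cons => /andP[s1 s2].
have l2n : l2 != [::] by case: (l2) ln => //= cE; move: cn; rewrite cE ltnn.
(* The moment factors at the cut [c]. The left half involves only segments ending at [c < n], the
   right half only segments starting at or after [c > 0]; all are shorter than [n], so the induction
   hypothesis telescopes both. *)
rewrite -cat_rcons cut_prod_cat last_rcons; congr (_ * _).
- apply: cut_prod_telescope; rewrite ?last_rcons //.
  + have := LP; rewrite -cat_rcons.
    by case: (rcons l1 c) s1 => //= d l' -> /(_ d)/[!mem_head]/elimT[//|u _ ->].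
  + by case: (l1).
  + move=> a c' /andP[_ ac'] c'c c'l.
    apply: (interval_exp_split adZ (change c' _ _)); rewrite ?ac' ?c'c //.
    * by lia.
    * by rewrite -cat_rcons mem_cat c'l.
    * by lia.
    * by apply: IH; lia.
- apply: cut_prod_telescope => // a c' /andP[ca ac'] c'n c'l.
  apply: (interval_exp_split adZ (change c' _ _)); rewrite ?ac' ?c'n //.
    by rewrite mem_cat inE c'l !orbT.
  by apply: IH; lia.
Qed.

(** Splitting is assumed only for shorter words, so that the formula is available inside an
    induction on the length. *)
Lemma bi_cumulant_change n (chi : 'I_n -> side) (omega : 'I_n -> K) (Z : 'I_n -> A) c :
  (forall m, (m < n)%N -> splits_at_changes m) ->
  adapted chi omega Z -> colour_change chi omega c ->
  bi_cumulant chi Z (one_chi n) =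
  interval_exp chi Z 0 n - interval_exp chi Z 0 c * interval_exp chi Z c n.
Proof.
move=> splits adZ ch; have /andP[_ cn] := colour_change_lt ch.
case: (ch) => [s [_ [sc _ _]]]; rewrite -sc in ch cn *.
apply: bi_cumulant_split => // a b acb bn ban.
exact: (interval_exp_split adZ ch acb bn (splits _ ban)).
Qed.

End Independence.

Theorem theorem8p5 (R : realType) (B : algType R[i]) (A : bb_ncps B)
    (K : Type) (AA : K -> set A * set A)
    (hAA : forall k : K, pair_of_algebras (AA k)) :
  bi_Boolean_independent AA <->
  (forall (n : nat) (chi : 'I_n -> side) (omega : 'I_n -> K) (Z : 'I_n -> A),
     (2 <= n)%N ->
     (forall j : 'I_n, pair_side (AA (omega j)) (chi j) (Z j)) ->
     ~ (forall i j : 'I_n, omega i = omega j) ->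
     bi_cumulant chi Z (one_chi n) = 0).
Proof.
split=> [/indep_splits_at_changes splits n chi omega Z _ adZ|cum0].
  move=> /(@colour_change_ex _ _ chi)[c ch].
  by rewrite (bi_cumulant_change (fun m _ => splits m) adZ ch) (splits _ _ _ _ adZ c ch) subrr.
(* Shorter words split by induction, so the cumulant of this word equals its splitting defect at
   [c], and its vanishing is the required splitting. *)
apply: splits_at_changes_indep => n; elim/ltn_ind: n => n IH chi omega Z adZ c ch.
have n2 : (2 <= n)%N by have := colour_change_lt ch; lia.
apply/eqP; rewrite -subr_eq0 -(bi_cumulant_change IH adZ ch); apply/eqP.
apply: (cum0 _ _ _ _ n2 adZ) => const.
by case: ch => [s [t [_ _ []]]].
Qed.
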